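(* Let $I$ be a finite category with $N$ objects and adjacency matrix $A_I$. Suppose $\det A_I\neq 0$ and that the polynomial $\det(E-A_Iz)$ factors as $$\det(E-A_Iz)=(-1)^N\det A_I\,(z-\alpha_1)^{e_1}\cdots(z-\alpha_n)^{e_n},$$ where each $\alpha_k\in\mathbb{C}$, each $e_k\ge 1$, and $\alpha_i\neq\alpha_j$ if $i\neq j$. Suppose also that the rational function $\frac{\mathrm{sum}(\mathrm{adj}(E-A_Iz)A_I)}{\det(E-A_Iz)}$ has the partial fraction decomposition $$\frac{\mathrm{sum}(\mathrm{adj}(E-A_Iz)A_I)}{\det(E-A_Iz)}=\frac{1}{(-1)^N\det A_I}\sum_{k=1}^n\sum_{j=1}^{e_k}\frac{A_{k,j}}{(z-\alpha_k)^j}$$ with complex numbers $A_{k,j}$. Then: (1) The zeta function of $I$ is $$\zeta_I(z)=\prod_{k=1}^n\frac{1}{\left(1-\frac{1}{\alpha_k}z\right)^{-\frac{A_{k,1}}{(-1)^N\det A_I}}}\times\exp\left(\frac{1}{(-1)^N\det A_I}\sum_{k=1}^n\sum_{j=1}^{e_k-1}\frac{z^j}{j\left(1-\frac{1}{\alpha_k}z\right)^j}\left(\sum_{i=j}^{e_k-1}j\binom{i}{j}(-1)^{i+1}\left(\frac{1}{\alpha_k}\right)^{i+j}\frac{A_{k,i+1}}{i}\right)\right).$$ (2) $$\sum_{k=1}^n-\frac{A_{k,1}}{(-1)^N\det A_I}=N.$$ (3) Each $\frac{1}{\alpha_k}$ is an eigenvalue of $A_I$. In particular, $\frac{1}{\alpha_k}$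 is an algebraic integer. (4) $$\sum_{k=1}^n\frac{-\frac{A_{k,1}}{(-1)^N\det A_I}}{\frac{1}{\alpha_k}}+\frac{1}{(-1)^N\det A_I}\sum_{k=1}^n\sum_{j=1}^{e_k-1}(-1)^j\,\frac{\sum_{i=j}^{e_k-1}\binom{i-1}{j-1}(-1)^{i-1}\left(\frac{1}{\alpha_k}\right)^{i+j}A_{k,i+1}}{\left(\frac{1}{\alpha_k}\right)^{j+1}}=\chi_\Sigma(I).$$
   Context: Let $I$ be a finite category with object set $\mathrm{Ob}(I)=\{x_1,\dots,x_N\}$. Its adjacency matrix $A_I$ is the $N\times N$ matrix whose $(i,j)$-entry is the number of morphisms in $I$ from $x_i$ to $x_j$. $E$ is the $N\times N$ identity matrix, $\mathrm{adj}$ denotes the adjugate matrix, and $\mathrm{sum}(M)$ denotes the sum of all entries of a matrix $M$. The zeta function of $I$ is $$\zeta_I(z)=\exp\left(\sum_{m=1}^\infty\frac{\#N_m(I)}{m}z^m\right),$$ where $N_m(I)$ is the set of all chains $x_0\xrightarrow{f_1}x_1\xrightarrow{f_2}\cdots\xrightarrow{f_m}x_m$ of $m$ composable morphisms in $I$ (identities allowed). It is regarded as a power series in $z$ (convergent near $z=0$); for complex $\beta$ and $c$, $(1-cz)^\beta$ means $\exp(\beta\log(1-cz))$ with the branch satisfying $\log 1=0$ at $z=0$. The series Euler characteristic $\chi_\Sigma(I)$ is the value at $t=-1$ (if it exists) of the rational function $$\frac{\mathrm{sum}(\mathrm{adj}(E-(A_I-E)t))}{\det(E-(A_I-E)t)}.$$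 When $\det A_I\neq 0$, this value exists and equals $\mathrm{sum}(A_I^{-1})$. The determinant $\det(E-A_Iz)$ equals $1$ at $z=0$, so all $\alpha_k$ are non-zero. *)

(* Defs.v *)
From HB Require Import structures.
From mathcomp Require Import all_boot all_order all_algebra.
From mathcomp Require Import all_classical all_reals all_analysis.
From mathcomp Require Import complex.

Set Implicit Arguments.
Unset Strict Implicit.
Unset Printing Implicit Defensive.

Import Order.TTheory GRing.Theory Num.Theory.
Import numFieldNormedType.Exports.

Local Open Scope classical_set_scope.
Local Open Scope ring_scope.
Local Open Scope complex_scope.

(* The usual topology of the complex numbers, given by the modulus. *)
HB.instance Definition _ (R : realType) := NormedModule.copy R[i] R[i]^o.

Section ComplexFunctions.
Variable R : realType.
Implicit Types z w b : R[i].

Definition Cexp z : R[i] :=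
  (expR (complex.Re z) * cos (complex.Im z)) +i* (expR (complex.Re z) * sin (complex.Im z)).

(* Principal argument, in `]-pi, pi]. *)
Definition Carg z : R :=
  let t := acos (complex.Re z / Normc.normc z) in if 0 <= complex.Im z then t else - t.

(* Principal logarithm: it is analytic off the nonpositive real half-line and
   Clog 1 = 0, so z |-> Clog (1 - c * z) is, near z = 0, the branch of
   log (1 - c * z) that vanishes at z = 0. *)
Definition Clog z : R[i] := ln (Normc.normc z) +i* Carg z.

Definition Cpow w b : R[i] := Cexp (b * Clog w).

End ComplexFunctions.

(* Composition is in diagrammatic order. *)
Record finCat := FinCat {
  Ob :> finType;
  Hom : Ob -> Ob -> finType;
  idm : forall x, Hom x x;
  comp : forall x y z, Hom x y -> Hom y z -> Hom x z;
  comp_idl : forall x y (f : Hom x y), comp (idm x) f = f;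
  comp_idr : forall x y (f : Hom x y), comp f (idm y) = f;
  comp_assoc : forall x y z t (f : Hom x y) (g : Hom y z) (h : Hom z t),
    comp f (comp g h) = comp (comp f g) h }.

Section FiniteCategory.
Variable I : finCat.

(* A morphism packed with its (source, target). *)
Definition arrow : finType := {p : I * I & Hom p.1 p.2}.
Definition src (f : arrow) : I := (tag f).1.
Definition tgt (f : arrow) : I := (tag f).2.

(* N_m(I), for m > 0: a chain of m >= 1 composable morphisms determines its
   objects. *)
Definition chains (m : nat) : {set m.-tuple arrow} :=
  [set c : m.-tuple arrow | sorted (fun f g => tgt f == src g) c].

Variable R : realType.

(* The term of index m is the one in z ^ m.+1: the sum starts at degree 1. *)
Definition zeta_term (z : R[i]) : R[i] ^nat :=
  fun m => #|chains m.+1|%:R / m.+1%:R * z ^+ m.+1.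

Definition zeta (z : R[i]) : R[i] := Cexp (limn (series (zeta_term z))).

Variables (N : nat) (x : 'I_N -> I).

Definition adjacency : 'M[R[i]]_N := \matrix_(i, j) #|Hom (x i) (x j)|%:R.

End FiniteCategory.

Arguments adjacency {I} R {N} x.

Definition mxsum (K : nmodType) m n (M : 'M[K]_(m, n)) : K :=
  \sum_i \sum_j M i j.

(* The matrix E - M t over K[t]. *)
Definition one_sub_mxX (K : nzRingType) n (M : 'M[K]_n) : 'M[{poly K}]_n :=
  1%:M - 'X *: map_mx polyC M.

(* The rational function f has value v at a: some representative p / q of f
   has q(a) <> 0 and p(a) / q(a) = v; such a v is unique. *)
Definition ratfun_value (K : fieldType) (f : {fraction {poly K}}) (a v : K) :=
  exists p q : {poly K},
    [/\ q.[a] != 0, f = tofrac p / tofrac q & v = p.[a] / q.[a]].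

(* The series Euler characteristic of I exists and equals v. *)
Definition series_Euler_char (I : finCat) (R : realType) (N : nat)
    (x : 'I_N -> I) (v : R[i]) :=
  let M := one_sub_mxX (adjacency R x - 1%:M) in
  ratfun_value (tofrac (mxsum (\adj M)) / tofrac (\det M)) (-1) v.

(* Main.v *)
Require Import Defs.
From mathcomp Require Import all_boot all_order all_algebra.
From mathcomp Require Import all_classical all_reals all_analysis.
From mathcomp Require Import complex.
From mathcomp Require Import perm ring lra zify.
Set Implicit Arguments.
Unset Strict Implicit.
Unset Printing Implicit Defensive.
Import Order.TTheory GRing.Theory Num.Theory.
Import numFieldNormedType.Exports.
Local Open Scope classical_set_scope.
Local Open Scope ring_scope.
Local Open Scope complex_scope.

(** Both the zeta function and the series Euler characteristic are read off the
    rational function f(z) = sum (adj (E - A z) A) / det (E - A z)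
    = sum ((E - A z)^-1 A), from its expansions at 0 and at infinity.

    At 0, the geometric series of A z gives the coefficients sum (A^(m+1)), which
    count the chains of m+1 morphisms ([card_chains]), while the partial fractions
    give combinations of the binomial coefficients of the powers (z - alpha_k)^-j.
    Both expansions satisfy the same linear equation modulo X^m, in which the
    factor det (E - A X) is 1 at 0, so that they agree ([mxsum_pow]). Hence log zeta,
    the primitive of f that vanishes at 0, is a combination of the primitives of
    the functions (z - alpha_k)^-j. Those with j > 1 are again powers
    ([cvg_negbin_primitive]); the one with j = 1 is the principal logarithm of
    1 - z / alpha_k ([cvg_log_series]), and it yields the factors of the product.
    Rewriting (1 - u)^-i - 1 in powers of u / (1 - u) gives the exponent in the
    stated form ([zeta_formula]).

    At infinity, z^2 f(z) = - N z - sum (A^-1) + O(1/z). On the partial fraction side,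
    only poles of order 1 contribute to the coefficient of z and only poles of order 1
    and 2 to the constant coefficient ([num_at_infinity]). The coefficient of z is the
    identity for N. The constant one is the identity for the Euler characteristic,
    because alternating sums of binomial coefficients cancel all the A_(k,i+1) with
    i > 1 ([sum_binomial_poles]) and the value at -1 defining the characteristic is
    sum (A^-1).

    A root alpha_k of det (E - A z) is the inverse of a root of the characteristic
    polynomial of A, which is monic with integer coefficients. *)

(** * Counting chains by powers of the adjacency matrix *)

Section Chains.
Variables (R : realType) (I : finCat) (N : nat) (x : 'I_N -> I).
Hypothesis x_bij : bijective x.
Local Notation A := (adjacency R x).
Local Notation composable := (fun f g : arrow I => tgt f == src g).

Lemma sum_arrow (V : nmodType) (F : I -> I -> V) :
  \sum_(f : arrow I) F (src f) (tgt f) =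
  \sum_i \sum_j F (x i) (x j) *+ #|Defs.Hom (x i) (x j)|.
Proof.
rewrite -(sig_big_dep predT (fun _ => predT) (fun p _ => F p.1 p.2)) /=.
rewrite -(pair_bigA _ (fun p q => \sum_(_ : Defs.Hom p q) F p q)) /=.
rewrite (reindex x) /=; last exact: onW_bij.
apply: eq_bigr => i _; rewrite (reindex x) /=; last exact: onW_bij.
by apply: eq_bigr => j _; rewrite sumr_const.
Qed.

Lemma sum_cons_tuple (V : nmodType) (T : finType) m (F : T -> m.-tuple T -> V) :
  \sum_(c : m.+1.-tuple T) F (thead c) (behead_tuple c) =
  \sum_f \sum_(c : m.-tuple T) F f c.
Proof.
rewrite pair_bigA (reindex (fun p : T * m.-tuple T => cons_tuple p.1 p.2)) /=.
  by apply: eq_bigr => -[f c] _; rewrite theadE; congr F; apply: val_inj.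
exists (fun c : m.+1.-tuple T => (thead c, behead_tuple c)) => [[f c] _|c _].
  by congr pair; apply: val_inj.
by rewrite [RHS]tuple_eta; apply: val_inj.
Qed.

Lemma sum_indicator (G : 'I_N -> R[i]) i :
  \sum_k (x i == x k)%:R * G k = G i.
Proof.
rewrite (bigD1 i) //= eqxx mul1r big1 ?addr0 // => k ki.
by rewrite (inj_eq (bij_inj x_bij)) eq_sym (negbTE ki) mul0r.
Qed.

(** Induction on the length: removing the first arrow of a path splits off one factor
    of the adjacency matrix. *)
Lemma sum_path_mxpow m f :
  \sum_(c : m.-tuple (arrow I)) (path composable f c)%:R
  = \sum_k (tgt f == x k)%:R * \sum_j (A ^+ m) k j.
Proof.
elim: m f => [|m IHm] f.
  rewrite (eq_bigl (pred1 [tuple])) ?big_pred1_eq => [|c]; last first.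
    exact/esym/eqP/tuple0.
  have [y _ yK] := x_bij; rewrite -[tgt f]yK sum_indicator.
  rewrite expr0 (bigD1 (y (tgt f))) //= mxE eqxx big1 ?addr0 // => j ij.
  by rewrite mxE eq_sym (negbTE ij).
under eq_bigr => c _ do rewrite [in path _ _ _](tuple_eta c) /= -mulnb natrM.
rewrite (sum_cons_tuple
  (fun g c => (tgt f == src g)%:R * (path composable g c)%:R)).
under eq_bigr => g _ do rewrite -mulr_sumr IHm.
rewrite (sum_arrow (fun p q => (tgt f == p)%:R
   * \sum_k (q == x k)%:R * \sum_j (A ^+ m) k j)).
apply: eq_bigr => i _; rewrite mulr_sumr.
under [in RHS]eq_bigr => j _ do rewrite exprS mxE mulr_sumr.
rewrite [RHS]exchange_big /=; apply: eq_bigr => k _.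
by rewrite sum_indicator -mulr_sumr -mulrnAr -mulr_sumr mxE !mulr_natl.
Qed.

Lemma card_chains m : #|chains I m.+1|%:R = mxsum (A ^+ m.+1).
Proof.
rewrite -sum1_card natr_sum big_mkcond /=.
transitivity (\sum_(c : m.+1.-tuple (arrow I))
    (path composable (thead c) (behead_tuple c))%:R : R[i]).
  apply: eq_bigr => c _; rewrite inE [in sorted _ _](tuple_eta c) /=.
  by case: path.
rewrite (sum_cons_tuple (fun f c => (path composable f c)%:R)).
under eq_bigr => g _ do rewrite sum_path_mxpow.
rewrite (sum_arrow (fun p q => \sum_k (q == x k)%:R * \sum_j (A ^+ m) k j)).
apply: eq_bigr => i _.
under [in RHS]eq_bigr => j _ do rewrite exprS mxE.
rewrite [RHS]exchange_big /=; apply: eq_bigr => k _.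
by rewrite sum_indicator -mulr_sumr mxE mulr_natl.
Qed.

End Chains.

(** * Expansions of the partial fraction decomposition *)

Section MxSum.
Variables (K : comNzRingType) (m n : nat).
Implicit Type M : 'M[K]_(m, n).

Lemma mxsumD M (M' : 'M[K]_(m, n)) : mxsum (M + M') = mxsum M + mxsum M'.
Proof.
rewrite /mxsum -big_split; apply: eq_bigr => i _; rewrite -big_split.
by apply: eq_bigr => j _; rewrite mxE.
Qed.

Lemma mxsumZ c M : mxsum (c *: M) = c * mxsum M.
Proof.
rewrite /mxsum mulr_sumr; apply: eq_bigr => i _; rewrite mulr_sumr.
by apply: eq_bigr => j _; rewrite mxE.
Qed.

Lemma mxsumN M : mxsum (- M) = - mxsum M.
Proof. by rewrite -scaleN1r mxsumZ mulN1r. Qed.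

Lemma mxsum_polyC M : mxsum (map_mx polyC M) = (mxsum M)%:P.
Proof.
rewrite /mxsum rmorph_sum; apply: eq_bigr => i _; rewrite rmorph_sum.
by apply: eq_bigr => j _; rewrite mxE.
Qed.

End MxSum.

Lemma mxsum1 (K : comNzRingType) n : mxsum (1%:M : 'M[K]_n) = n%:R.
Proof.
rewrite /mxsum -[n in RHS]card_ord -sumr_const; apply: eq_bigr => i _.
rewrite (bigD1 i) //= mxE eqxx big1 ?addr0 // => j ji.
by rewrite mxE eq_sym (negbTE ji).
Qed.

Section TruncatedCongruence.
Variables (K : idomainType) (m : nat).
Implicit Types p q r : {poly K}.

(** Congruence modulo X^m, in the form in which multiplication and the cancellation of
    power series with invertible constant term follow from [coefM]. *)
Definition eqpX p q := forall i, (i < m)%N -> p`_i = q`_i.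

Lemma eqpXM r p q : eqpX p q -> eqpX (r * p) (r * q).
Proof.
move=> pq i im; rewrite !coefM; apply: eq_bigr => j _; congr (_ * _).
by apply: pq; apply: leq_ltn_trans im; rewrite leq_subr.
Qed.

Lemma eqpXMI r p q : r`_0 != 0 -> eqpX (r * p) (r * q) -> eqpX p q.
Proof.
move=> r0 rpq i; elim/ltn_ind: i => i IHi im.
(* The coefficients of lower index agree by induction; only the one multiplied by
   the constant term of [r] is left. *)
have := rpq i im; rewrite !coefM !big_ord_recl /= !subn0.
rewrite [X in _ + X = _](eq_bigr (fun j : 'I_i => r`_(bump 0 j) * q`_(i - bump 0 j))).
  by move/addIr/(mulfI r0).
move=> j _; congr (_ * _); have ji := ltn_ord j.
by apply: IHi; rewrite /bump /=; lia.
Qed.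

Lemma eqpX_sum (I : finType) (p q : I -> {poly K}) :
  (forall k, eqpX (p k) (q k)) -> eqpX (\sum_k p k) (\sum_k q k).
Proof. by move=> pq i im; rewrite !coef_sum; apply: eq_bigr => k _; apply: pq. Qed.

End TruncatedCongruence.

(** The telescoping identity (1 - X A) (1 + X A + ... + X^(m-1) A^(m-1)) = 1 - X^m A^m,
    multiplied by the adjugate on the left and by A on the right. *)
Lemma eqpX_neumann (K : idomainType) N (A : 'M[K]_N) m :
  eqpX m (\det (one_sub_mxX A) * \poly_(i < m) mxsum (A ^+ i.+1))
         (mxsum (\adj (one_sub_mxX A) *m map_mx polyC A)).
Proof.
set P := one_sub_mxX A; set B := map_mx polyC A.
pose S := \sum_(i < m) 'X^i *: map_mx polyC (A ^+ i).
have PS : P *m S = 1%:M - 'X^m *: map_mx polyC (A ^+ m).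
  rewrite /S; elim: (m) => [|k IHk].
    by rewrite big_ord0 mulmx0 !expr0 map_mx1 scale1r subrr.
  rewrite big_ord_recr mulmxDr IHk /= mulmxBl mul1mx -scalemxAl -scalemxAr.
  by rewrite scalerA -exprS -map_mxM -[A *m A ^+ k]exprS addrA subrK.
have -> : \det P * \poly_(i < m) mxsum (A ^+ i.+1)
    = mxsum (\adj P *m B) - 'X^m * mxsum (\adj P *m map_mx polyC (A ^+ m.+1)).
  have -> : \poly_(i < m) mxsum (A ^+ i.+1) = mxsum (S *m B).
    rewrite poly_def /S mulmx_suml.
    elim/big_rec2: _ => [|i p M _ ->]; last first.
      rewrite mxsumD -scalemxAl mxsumZ -map_mxM mxsum_polyC.
      by rewrite -[A ^+ i *m A]exprSr mulrC mul_polyC.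
    by rewrite /mxsum big1 // => i _; rewrite big1 // => j _; rewrite mxE.
  rewrite -mxsumZ -mul_scalar_mx -mul_adj_mx -mulmxA (mulmxA P S) PS.
  rewrite mulmxBl mul1mx mulmxBr -scalemxAl -map_mxM -[A ^+ m *m A]exprSr.
  by rewrite -scalemxAr mxsumD mxsumN mxsumZ.
by move=> i im; rewrite coefB coefXnM im subr0.
Qed.

(** The truncation of the expansion of (X - c)^-(j+1) at 0. *)
Definition negbinom_poly (K : fieldType) (c : K) m j : {poly K} :=
  \poly_(i < m) ((-1) ^+ j.+1 * (c ^- (j.+1 + i)) * 'C(i + j, j)%:R).

(** Multiplying by X - c lowers the exponent j by one, by Pascal's rule. *)
Lemma eqpX_negbinom (K : fieldType) (c : K) m j : c != 0 ->
  eqpX m (('X - c%:P) ^+ j.+1 * negbinom_poly c m j) 1.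
Proof.
move=> c0; have cV l : c * c ^- l.+1 = c ^- l.
  by rewrite exprS invfM mulrA mulfV // mul1r.
elim: j => [|j IHj].
  move=> i im; rewrite expr1 mulrBl coefB coefXM coefCM !coef_poly im coefC.
  rewrite expr1 add1n !addn0 !bin0 !mulr1 !mulN1r mulrN cV.
  case: i im => [|i] im /=; first by rewrite sub0r opprK expr0 invr1.
  by rewrite (ltnW im) subrr.
move=> i im; rewrite -(IHj i im) exprSr -mulrA; move: i im; apply: eqpXM => i im.
rewrite mulrBl coefB coefXM coefCM !coef_poly im mulrA (mulrCA c) (addSn j.+1 i) cV.
rewrite (exprS _ j.+1) mulN1r !mulNr opprK.
case: i im => [|i] im; first by rewrite eqxx add0r !add0n !binn addSn.
rewrite -[i.+1 == 0]/false -[i.+1.-1]/i (ltnW im) (addSn i j.+1) binS natrD.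
rewrite (addSnnS i j) (addnS j.+1 i) mulrDr. by rewrite addKr.
Qed.

Lemma size_det_leq (K : idomainType) n (M : 'M[{poly K}]_n) :
  (forall i j, (size (M i j) <= 2)%N) -> (size (\det M) <= n.+1)%N.
Proof.
move=> M2; rewrite /determinant; apply: (leq_trans (size_sum _ _ _)).
apply/bigmax_leqP => s _; rewrite size_Msign.
apply: (leq_trans (size_poly_prod_leq _ _)).
have : (\sum_i size (M i (s i)) <= \sum_(i < n) 2)%N by apply: leq_sum.
by rewrite sum_nat_const !card_ord leq_subLR addnS ltnS addnn muln2.
Qed.

Lemma size_adj_leq (K : idomainType) n (M : 'M[{poly K}]_n) i j :
  (forall i j, (size (M i j) <= 2)%N) -> (size ((\adj M) i j) <= n)%N.
Proof.
move=> M2; rewrite mxE /cofactor size_Msign; case: n M i j M2 => [|n] M i j M2.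
  by case: i.
by apply: size_det_leq => k l; rewrite !mxE.
Qed.

Section PartialFractions.
Variables (K : fieldType) (N : nat) (A : 'M[K]_N).
Variables (n : nat) (alpha : 'I_n -> K) (e : 'I_n -> nat) (a : 'I_n -> nat -> K).
Local Notation P := (one_sub_mxX A).
Local Notation num := (mxsum (\adj P *m map_mx polyC A)).
Variable d : K.
Hypothesis d_neq0 : d != 0.

Definition roots_poly : {poly K} := \prod_(k < n) ('X - (alpha k)%:P) ^+ e k.

Hypothesis detP : \det P = d%:P * roots_poly.
Hypothesis partial_fractions :
  tofrac num / tofrac (\det P) =
    (tofrac d%:P)^-1 *
    \sum_(k < n) \sum_(1 <= j < (e k).+1)
      tofrac (a k j)%:P / tofrac ('X - (alpha k)%:P) ^+ j.

(** The quotient of [roots_poly] by (X - alpha k)^j, for j at most e k. *)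
Definition roots_quo k j : {poly K} :=
  ('X - (alpha k)%:P) ^+ (e k - j)
  * \prod_(l < n | l != k) ('X - (alpha l)%:P) ^+ e l.

Lemma roots_quoK k j : (j <= e k)%N ->
  ('X - (alpha k)%:P) ^+ j * roots_quo k j = roots_poly.
Proof.
by move=> jk; rewrite mulrA -exprD subnKC // [RHS](bigD1 k).
Qed.

Lemma roots_poly_neq0 : roots_poly != 0.
Proof. by apply/prodf_neq0 => k _; rewrite expf_neq0 // polyXsubC_eq0. Qed.

(** Clearing denominators turns the decomposition into an identity of polynomials. *)
Lemma num_partial_fractions :
  num = \sum_(k < n) \sum_(1 <= j < (e k).+1) a k j *: roots_quo k j.
Proof.
have dP0 : (d%:P : {poly K}) != 0 by rewrite polyC_eq0.
have frac0 (p : {poly K}) : p != 0 -> tofrac p != 0 by rewrite tofrac_eq0.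
apply/eqP; rewrite -tofrac_eq; apply/eqP.
have := partial_fractions.
rewrite detP => /(canRL (divfK (frac0 _ (mulf_neq0 dP0 roots_poly_neq0)))) ->.
rewrite tofracM mulrACA mulrA mulVf ?frac0 // mul1r.
rewrite rmorph_sum mulr_suml; apply: eq_bigr => k _.
rewrite rmorph_sum mulr_suml !big_nat; apply: eq_bigr => j /andP[_ jk].
rewrite -(roots_quoK jk) tofracM [tofrac (_ ^+ j)]rmorphXn mulrA divfK.
  by rewrite -tofracM mul_polyC.
by rewrite expf_neq0 // frac0 // polyXsubC_eq0.
Qed.

Lemma det_one_sub_mxX_0 : (\det P).[0] = 1.
Proof.
rewrite -horner_evalE -det_map_mx /=.
rewrite (_ : map_mx _ _ = 1%:M) ?det1 //; apply/matrixP => i j.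
rewrite !mxE /horner_eval hornerD hornerN hornerM hornerX mul0r subr0.
by case: (i == j); rewrite hornerE.
Qed.

Lemma pole_neq0 k : (0 < e k)%N -> alpha k != 0.
Proof.
move=> ek; apply/eqP => ak0; have := det_one_sub_mxX_0.
rewrite detP hornerM -(roots_quoK ek) expr1 hornerM hornerXsubC ak0 subrr.
by rewrite mul0r mulr0 => /esym/eqP; rewrite oner_eq0.
Qed.

(** Both sides are the coefficient of index m of the rational function [num / \det P],
    expanded at 0 from the matrix inverse on the left and from the partial fractions
    on the right. *)
Theorem mxsum_pow m : (forall k, (0 < e k)%N) ->
  mxsum (A ^+ m.+1) = d^-1 * \sum_(k < n) \sum_(1 <= j < (e k).+1)
    a k j * ((-1) ^+ j * alpha k ^- (j + m) * 'C(m + j.-1, j.-1)%:R).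
Proof.
move=> e_gt0.
pose T := \sum_(k < n) \sum_(0 <= j < e k)
  a k j.+1 *: negbinom_poly (alpha k) m.+1 j.
have rT : eqpX m.+1 (roots_poly * T) num.
  rewrite num_partial_fractions mulr_sumr; apply: eqpX_sum => k.
  rewrite big_add1 /= !big_mkord mulr_sumr; apply: eqpX_sum => j i im.
  rewrite -(roots_quoK (ltn_ord j)) -!scalerAr !coefZ; congr (_ * _).
  rewrite mulrAC mulrC -[in RHS](mulr1 (roots_quo _ _)); move: i im.
  by apply: eqpXM; apply: eqpX_negbinom; apply: pole_neq0.
have dT : eqpX m.+1 (d *: \poly_(i < m.+1) mxsum (A ^+ i.+1)) T.
  apply: (@eqpXMI _ _ roots_poly) => [|i im].
    apply/eqP => r0; have := det_one_sub_mxX_0; rewrite detP horner_coef0.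
    by rewrite coefCM r0 mulr0 => /esym/eqP; rewrite oner_eq0.
  rewrite -scalerAr -mul_polyC mulrA -detP rT //.
  exact: eqpX_neumann.
have := dT m (ltnSn m); rewrite coefZ coef_poly ltnSn => /(canRL (mulKf d_neq0)) ->.
congr (_ * _); rewrite coef_sum; apply: eq_bigr => k _.
rewrite coef_sum big_add1; apply: eq_bigr => j _.
by rewrite coefZ coef_poly ltnSn.
Qed.

Section AtInfinity.
Hypothesis detA : \det A != 0.
Hypothesis dE : d = (-1) ^+ N * \det A.
Local Notation B := (map_mx polyC A).
Local Notation C := (invmx A).

(** At infinity, (1 - X A)^-1 expands in powers of A^-1: the factor A^-1 - X below is
    what the recursion for the leading terms inverts. *)
Lemma one_sub_mxX_factor : P = B *m (map_mx polyC C - 'X%:M).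
Proof.
rewrite mulmxBr -map_mxM mulmxV ?unitmxE ?unitfE // map_mx1.
by rewrite mul_mx_scalar.
Qed.

Lemma size_roots_poly : size roots_poly = N.+1.
Proof.
(* The roots of det (1 - X A) are the eigenvalues of A^-1. *)
have : d%:P * roots_poly = d%:P * char_poly C.
  rewrite -detP one_sub_mxX_factor det_mulmx det_map_mx -opprB -scaleN1r detZ.
  by rewrite mulrA dE rmorphM /= rmorphXn rmorphN rmorph1 (mulrC (_%:P)).
by move/(mulfI _) => ->; rewrite ?polyC_eq0 // size_char_poly.
Qed.

(** As Y = adj (1 - X A) A satisfies X Y = Y A^-1 - det (1 - X A), multiplying Y twice
    by X extracts the two leading terms of its expansion at infinity; the remainder is
    given by the adjugate, whose entries have degree less than N. *)
Lemma mulX2_num : 'X ^+ 2 * num =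
  mxsum (\adj P *m map_mx polyC C) - \det P * ('X * N%:R + (mxsum C)%:P).
Proof.
pose Y := \adj P *m B; rewrite -/Y.
have YX : 'X *: Y = Y *m map_mx polyC C - (\det P)%:M.
  rewrite -mul_adj_mx {2}one_sub_mxX_factor mulmxA -/Y mulmxBr opprB addrCA.
  by rewrite subrr addr0 mul_mx_scalar.
have BC : B *m map_mx polyC C = 1%:M.
  by rewrite -map_mxM mulmxV ?unitmxE ?unitfE // map_mx1.
have YC : Y *m map_mx polyC C = \adj P by rewrite -mulmxA BC mulmx1.
rewrite expr2 -mulrA -!mxsumZ YX YC scalerBr.
have -> : 'X *: \adj P = \adj P *m map_mx polyC C - \det P *: map_mx polyC C.
  rewrite -{1}YC scalemxAl YX YC mulmxBl mul_scalar_mx.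
  by [].
rewrite !mxsumD !mxsumN mxsumZ mxsum_polyC scale_scalar_mx -scalemx1 mxsumZ.
by rewrite mxsum1; ring.
Qed.

(** The polynomial part of X^2 / (X - alpha k)^j, for j > 0. *)
Definition quo_lead k (j : nat) : {poly K} :=
  if j == 1 then 'X + (alpha k)%:P else (j == 2)%:R.

Lemma size_roots_quo k j :
  (j <= e k)%N -> (size (roots_quo k j) + j = N.+1)%N.
Proof.
move=> jk; rewrite -size_roots_poly -(roots_quoK jk).
rewrite [RHS]size_monicM ?monic_exp ?monicXsubC //.
  by rewrite size_exp_XsubC addSn addnC.
by apply: contra_eq_neq (roots_quoK jk) => ->; rewrite mulr0 eq_sym roots_poly_neq0.
Qed.

Lemma size_quo_lead k j : (0 < j <= e k)%N ->
  (size ('X ^+ 2 * roots_quo k j - quo_lead k j * roots_poly)%R <= N)%N.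
Proof.
move=> /andP[j0 jk]; have sz := size_roots_quo jk.
rewrite -(roots_quoK jk) (mulrA (quo_lead k j)) -mulrBl.
have mulq (p : {poly K}) : (size p <= j)%N -> (size (p * roots_quo k j)%R <= N)%N.
  by move=> pj; apply: (leq_trans (size_polyMleq _ _)); lia.
apply: mulq; rewrite /quo_lead.
case: j j0 jk sz => [|[|[|j]]] // _ _ _ /=.
- rewrite expr1 (_ : _ - _ = (alpha k ^+ 2)%:P) ?size_polyC_leq1 //.
  by rewrite rmorphXn /=; ring.
- rewrite (_ : _ - _ = (2 * alpha k)%:P * 'X + (- alpha k ^+ 2)%:P).
    by rewrite size_MXaddC; case: ifP => // _; rewrite ltnS size_polyC_leq1.
  by rewrite rmorphN rmorphM rmorphXn /= -[2%:P]/(polyC 2%:R) rmorph_nat; ring.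
- by rewrite mulr0n mul0r subr0 size_polyXn.
Qed.

(** Comparing the two expressions of X^2 [num] gives a polynomial D of degree at most 1
    such that D [roots_poly] has degree less than N; as [roots_poly] has degree N,
    D vanishes, and its two coefficients are the claims. *)
Lemma num_at_infinity : (forall k, (0 < e k)%N) ->
  \sum_(k < n) a k 1%N = - (d * N%:R) /\
  \sum_(k < n) (a k 1%N * alpha k + (if (1 < e k)%N then a k 2%N else 0))
    = - (d * mxsum C).
Proof.
(* [L] collects the polynomial parts of the partial fractions, and [D] subtracts those
   of the matrix expression [mulX2_num]. *)
move=> e_gt0; pose L := \sum_(k < n) \sum_(1 <= j < (e k).+1) a k j *: quo_lead k j.
pose D := L + d%:P * ('X * N%:R + (mxsum C)%:P).
have small_sum (I : Type) (r : seq I) (Q : pred I) (F : I -> {poly K}) :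
    (forall i, Q i -> (size (F i) <= N)%N) -> (size (\sum_(i <- r | Q i) F i)%R <= N)%N.
  move=> FN; elim/big_ind: _ => // [|p q pN qN]; first by rewrite size_poly0.
  by apply: (leq_trans (size_polyD _ _)); rewrite geq_max pN.
have : (size (D * roots_poly)%R <= N)%N.
  have -> : D * roots_poly = mxsum (\adj P *m map_mx polyC C)
     - \sum_(k < n) \sum_(1 <= j < (e k).+1)
         a k j *: ('X ^+ 2 * roots_quo k j - quo_lead k j * roots_poly).
    have -> : \sum_(k < n) \sum_(1 <= j < (e k).+1)
         a k j *: ('X ^+ 2 * roots_quo k j - quo_lead k j * roots_poly)
       = 'X ^+ 2 * num - L * roots_poly.
      rewrite num_partial_fractions mulr_sumr mulr_suml -sumrB.
      apply: eq_bigr => k _; rewrite mulr_sumr mulr_suml -sumrB.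
      by apply: eq_bigr => j _; rewrite -scalerAr -scalerAl scalerBr.
    by rewrite mulX2_num detP /D; ring.
  apply: (leq_trans (size_polyD _ _)); rewrite geq_max size_polyN.
  apply/andP; split.
    apply: (small_sum) => i _; apply: (small_sum) => j _.
    rewrite mxE; apply: (small_sum) => l _; rewrite [map_mx _ _ _ _]mxE mulrC mul_polyC.
    apply: (leq_trans (size_scale_leq _ _)); apply: size_adj_leq => u v.
    rewrite !mxE -polyCMn; apply: (leq_trans (size_polyD _ _)).
    rewrite geq_max size_polyN mulrC (leq_trans (size_polyC_leq1 _)) //=.
    apply: (leq_trans (size_polyMleq _ _)); rewrite size_polyX addn2 /= ltnS.
    exact: size_polyC_leq1.
  apply: (small_sum) => k _; rewrite big_nat_cond; apply: small_sum => j.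
  rewrite andbT => jk; apply: (leq_trans (size_scale_leq _ _)).
  exact: size_quo_lead.
have [D0 _|Dn0] := eqVneq D 0; last first.
  rewrite size_mul ?roots_poly_neq0 // size_roots_poly addnS /=.
  move: Dn0; rewrite -size_poly_gt0.
  by case: (size D) => // m _; rewrite addSn ltnNge leq_addl.
have LE : L = 'X * (\sum_(k < n) a k 1%N)%:P +
    (\sum_(k < n) (a k 1%N * alpha k + (if (1 < e k)%N then a k 2%N else 0)))%:P.
  rewrite !rmorph_sum mulr_sumr -big_split; apply: eq_bigr => k _ /=.
  rewrite big_ltn ?ltnS ?e_gt0 // {1}/quo_lead /=; case: (ltnP 1 (e k)) => ek; last first.
    rewrite big_geq // addr0 -mul_polyC addr0 rmorphM /=; ring.
  rewrite big_ltn // big_nat big1 ?addr0 => [|j /andP[j2 _]].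
    by rewrite /quo_lead /= mulr1n -!mul_polyC rmorphD rmorphM /=; ring.
  by rewrite /quo_lead; case: j j2 => [|[|[|j]]] //= _; rewrite mulr0n scaler0.
have [c0 c1] := (congr1 (coefp 0) D0, congr1 (coefp 1) D0).
move: c0 c1; rewrite /D LE -polyC_natr /= !(coefD, coefCM, coefXM, coefC, coef0) /=.
rewrite !add0r !addr0 => /addr0_eq <- /addr0_eq <-.
by rewrite !opprK.
Qed.

End AtInfinity.

Lemma eigenvalue_pole k : (0 < e k)%N -> eigenvalue A (alpha k)^-1.
Proof.
move=> ek; have ak0 := pole_neq0 ek.
have : (\det P).[alpha k] = 0.
  by rewrite detP -(roots_quoK ek) expr1 !hornerM hornerXsubC subrr mul0r mulr0.
rewrite -horner_evalE -det_map_mx eigenvalue_root_char /root /char_poly /=.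
rewrite -horner_evalE -det_map_mx /= => det0.
rewrite (_ : map_mx _ _ = (alpha k)^-1 *: map_mx (horner_eval (alpha k)) P).
  by rewrite detZ det0 mulr0.
apply/matrixP => i j; rewrite !mxE /horner_eval !hornerE.
by case: (i == j); rewrite !hornerE; field.
Qed.

End PartialFractions.

(** * Integrality of the eigenvalues and the series Euler characteristic *)

(** The characteristic polynomial of an integer matrix is monic with integer
    coefficients. *)
Lemma integralOver_eigenvalue (K : fieldType) N (A : 'M[K]_N) (M : 'M[nat]_N) c :
  A = map_mx (fun m => m%:R) M -> eigenvalue A c ->
  integralOver (intr : int -> K) c.
Proof.
move=> ->; rewrite eigenvalue_root_char => rc.
exists (char_poly (map_mx (fun m => m%:Z) M)); first exact: char_poly_monic.
rewrite map_char_poly -map_mx_comp; exact: rc.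
Qed.

Lemma exchange_triangle (V : nmodType) (e : nat) (F : nat -> nat -> V) :
  \sum_(1 <= j < e) \sum_(j <= i < e) F j i =
  \sum_(1 <= i < e) \sum_(1 <= j < i.+1) F j i.
Proof.
transitivity (\sum_(1 <= j < e) \sum_(1 <= i < e | (j <= i)%N) F j i).
  rewrite !big_nat; apply: eq_bigr => j /andP[j1 _].
  by rewrite (big_nat_widenl _ 1%N).
rewrite (exchange_big_dep_nat xpredT) //= !big_nat.
apply: eq_bigr => i /andP[_ ie]; rewrite [RHS](big_nat_widen _ _ e) //.
Qed.

Lemma sum_alternating_bin (K : fieldType) i :
  \sum_(1 <= j < i.+2) (-1) ^+ j * 'C(i, j.-1)%:R = - (i == 0%N)%:R :> K.
Proof.
rewrite big_add1 /= big_mkord -expr0n -[0 as X in X ^+ i](subrr 1) exprDn -sumrN.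
by apply: eq_bigr => j _; rewrite expr1n mul1r exprS mulN1r mulNr mulr_natr.
Qed.

(** After exchanging the sums, the coefficient of [b i.+1] is an alternating sum of the
    row i - 1 of Pascal's triangle, which vanishes unless i = 1. *)
Lemma sum_binomial_poles (K : fieldType) (c : K) (e : nat) (b : nat -> K) : c != 0 ->
  \sum_(1 <= j < e) (-1) ^+ j *
     ((\sum_(j <= i < e)
        'C(i.-1, j.-1)%:R * (-1) ^+ i.-1 * (1 / c) ^+ (i + j) * b i.+1)
      / (1 / c) ^+ j.+1)
  = - (if (1 < e)%N then b 2%N else 0).
Proof.
move=> c0; pose G i := (-1) ^+ i.-1 * c * (1 / c) ^+ i * b i.+1.
transitivity (\sum_(1 <= i < e) \sum_(1 <= j < i.+1)
    ((-1) ^+ j * 'C(i.-1, j.-1)%:R * G i)).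
  rewrite -exchange_triangle; apply: eq_bigr => j _.
  rewrite mulr_suml mulr_sumr; apply: eq_bigr => i _.
  by rewrite /G exprD exprS; field; rewrite c0 expf_neq0 // div1r invr_eq0.
under eq_bigr => i _ do rewrite -mulr_suml.
case: (ltnP 1 e) => e1; last by rewrite big_geq // oppr0.
rewrite big_ltn // (sum_alternating_bin K 0) big_nat big1 ?addr0 => [|[|[|i]] // _].
  by rewrite /G eqxx mulr1n expr0 mul1r expr1 div1r mulfV // mul1r mulN1r.
by rewrite (sum_alternating_bin K i.+1) mulr0n oppr0 mul0r.
Qed.

(** The matrix E - (A - E) t is A at t = -1, so the given fraction has a nonzero
    denominator there. *)
Lemma series_Euler_char_invmx (R : realType) (I : finCat) (N : nat)
    (x : 'I_N -> I) : \det (adjacency R x) != 0 ->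
  series_Euler_char x (mxsum (invmx (adjacency R x))).
Proof.
set A := adjacency R x => detA; rewrite /series_Euler_char -/A.
set M := one_sub_mxX _; exists (mxsum (\adj M)), (\det M).
have MA : map_mx (horner_eval (-1)) M = A.
  apply/matrixP => i j; rewrite !mxE /horner_eval !hornerE.
  by case: (i == j); rewrite !hornerE mulN1r opprK ?subr0 // addrCA subrr addr0.
have detM : (\det M).[-1] = \det A.
  by rewrite -horner_evalE -det_map_mx MA.
rewrite detM; split=> //.
have -> : (mxsum (\adj M)).[-1] = mxsum (\adj A).
  rewrite -MA -map_mx_adj horner_sum; apply: eq_bigr => i _.
  by rewrite horner_sum; apply: eq_bigr => j _; rewrite [RHS]mxE.
by rewrite /invmx unitmxE unitfE detA mxsumZ mulrC.
Qed.

(** * Power series of complex powers and logarithms *)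

Lemma bin_leq_exp2 n k : ('C(n, k) <= 2 ^ n)%N.
Proof.
elim: n k => [|n IHn] [|k] //; first by rewrite bin0 expn_gt0.
by rewrite binS expnS mul2n -addnn leq_add.
Qed.

Section ComplexSeries.
Variable R : realType.
Local Notation C := R[i].
Local Notation normc := (@Normc.normc R).

(** Convergence in the complex plane is tested by positive elements of the complex field,
    which are real; the bound is therefore stated with the real-valued modulus. *)
Lemma cvg_geometric_bound (f : nat -> C) (l : C) (c q : R) : 0 <= q < 1 ->
  (forall n, normc (f n - l) <= c * q ^+ n) -> f @ \oo --> l.
Proof.
move=> /andP[q0 q1] fl; apply/cvgrPdist_lt => eps eps0.
have epsE : eps = (complex.Re eps)%:C.
  by move: eps0; case: (eps) => a b; rewrite ltcE /= => /andP[/eqP -> _].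
have Reps0 : 0 < complex.Re eps by rewrite epsE ltcR in eps0.
have : c * q ^+ n @[n --> \oo] --> (0 : R).
  by apply: (@cvg_geometric _ c q); rewrite ger0_norm.
move/cvgrPdist_lt => /(_ _ Reps0); apply: filterS => n.
rewrite sub0r normrN distrC epsE => cq.
rewrite (_ : `|f n - l| = (normc (f n - l))%:C) // ltcR.
by apply: (le_lt_trans (fl n)); apply: le_lt_trans cq; rewrite ler_norm.
Qed.

Lemma cvg_to_eq (f : nat -> C) (l m : C) :
  l = m -> f @ \oo --> l -> f @ \oo --> m.
Proof. by move=> ->. Qed.

Lemma cvgCMl (f : nat -> C) (l b : C) :
  f @ \oo --> l -> b * f n @[n --> \oo] --> b * l.
Proof. exact: cvgMl_tmp. Qed.

Lemma cvgCB (f g : nat -> C) (l m : C) :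
  f @ \oo --> l -> g @ \oo --> m -> f n - g n @[n --> \oo] --> l - m.
Proof. exact: cvgB. Qed.

Lemma normc_ge0 (z : C) : 0 <= normc z.
Proof. by case: z => a b; apply: sqrtr_ge0. Qed.

Lemma normcR (r : R) : normc r%:C = `|r|.
Proof. by rewrite /= expr0n addr0 sqrtr_sqr. Qed.

Lemma normcX (z : C) n : normc (z ^+ n) = normc z ^+ n.
Proof.
by elim: n => [|n IHn]; rewrite ?Normc.normc1 // !exprS Normc.normcM IHn.
Qed.

Lemma normc_nat n : normc n%:R = n%:R.
Proof.
apply: complexI; rewrite -[LHS]/(`|n%:R : C|) normr_nat.
by rewrite (rmorph_nat (real_complex R)).
Qed.

Section NegativeBinomial.
Variable u : C.
Hypothesis u_small : normc u <= 4^-1.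

Lemma one_sub_neq0 : 1 - u != 0.
Proof.
rewrite subr_eq0; apply/eqP => u1; move: u_small.
by rewrite -u1 Normc.normc1; lra.
Qed.

Lemma cvg_bin_pow0 j : 'C(n + j, j.+1)%:R * u ^+ n @[n --> \oo] --> (0 : C).
Proof.
apply: (@cvg_geometric_bound _ _ (2 ^+ j) (2^-1)) => [|n]; first by lra.
rewrite subr0 Normc.normcM normc_nat normcX.
(* The binomial coefficient is at most 2^(n + j); this is why u is kept within 1/4. *)
apply: (@le_trans _ _ (2 ^+ (n + j) * 4^-1 ^+ n)).
  apply: ler_pM => //; rewrite ?exprn_ge0 ?normc_ge0 //.
    by rewrite -natrX ler_nat; apply: bin_leq_exp2.
  by rewrite lerXn2r ?nnegrE ?normc_ge0.
rewrite exprD mulrAC -exprMn mulrC ler_wpM2l ?exprn_ge0 //.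
by rewrite (_ : 2 * 4^-1 = 2^-1) //; lra.
Qed.

(** The partial sums of the expansion of (1 - u)^-(j+1). *)
Definition negbin_sum j n : C := \sum_(m < n) 'C(m + j, j)%:R * u ^+ m.

Lemma negbin_sum0 n : (1 - u) * negbin_sum 0 n = 1 - u ^+ n.
Proof.
rewrite /negbin_sum -(opprB u) -(opprB _ 1) subrX1 mulNr; congr (- (_ * _)).
by apply: eq_bigr => m _; rewrite bin0 mul1r.
Qed.

(** Pascal's rule; the boundary term tends to 0. *)
Lemma negbin_sumS j n : (1 - u) * negbin_sum j.+1 n =
  negbin_sum j n - 'C(n + j, j.+1)%:R * u ^+ n.
Proof.
rewrite /negbin_sum; elim: n => [|n IHn].
  by rewrite !big_ord0 mulr0 add0n bin_small // mul0r subr0.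
rewrite !big_ord_recr mulrDr IHn (addnS n j) (addSn n j) !binS !natrD exprS /=.
by ring.
Qed.

Lemma cvg_negbin_sum j : negbin_sum j n @[n --> \oo] --> (1 - u) ^- j.+1.
Proof.
have u1 := one_sub_neq0; elim: j => [|j IHj].
  have -> : negbin_sum 0 = fun n => (1 - u)^-1 * (1 - u ^+ n).
    by apply/funext => n; rewrite -negbin_sum0 mulKf.
  have un0 : u ^+ n @[n --> \oo] --> (0 : C).
    apply: (@cvg_geometric_bound _ _ 1 4^-1) => [|n]; first by lra.
    by rewrite subr0 mul1r normcX lerXn2r ?nnegrE ?normc_ge0.
  apply: (cvg_to_eq _ (cvgCMl (b := (1 - u)^-1) (cvgCB (cvg_cst (1 : C)) un0))).
  by rewrite expr1 subr0 mulr1.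
have -> : negbin_sum j.+1 =
    fun n => (1 - u)^-1 * (negbin_sum j n - 'C(n + j, j.+1)%:R * u ^+ n).
  by apply/funext => n; rewrite -negbin_sumS mulKf.
apply: (cvg_to_eq _ (cvgCMl (b := (1 - u)^-1) (cvgCB IHj (cvg_bin_pow0 j)))).
by rewrite subr0 -invfM -exprS.
Qed.

(** Integrating the expansion of (1 - u)^-(j+2) term by term. *)
Lemma cvg_negbin_primitive j :
  \sum_(m < n) ('C(m + j.+1, j.+1)%:R / m.+1%:R * u ^+ m.+1) @[n --> \oo]
    --> j.+1%:R^-1 * ((1 - u) ^- j.+1 - 1).
Proof.
have -> : (fun n => \sum_(m < n) ('C(m + j.+1, j.+1)%:R / m.+1%:R * u ^+ m.+1)) =
    (fun n => j.+1%:R^-1 * (negbin_sum j n.+1 - 1)).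
  apply/funext => n; rewrite /negbin_sum big_ord_recl expr0 binn mulr1 addrC addKr.
  rewrite mulr_sumr; apply: eq_bigr => m _; rewrite mulrA; congr (_ * _).
  have /(congr1 (fun k => k%:R : C)) := mul_bin_left (m + j.+1) j.
  rewrite addnS subSn ?leq_addl // addnK !natrM => E.
  have [m0 j0] : (m.+1%:R != 0 :> C) /\ (j.+1%:R != 0 :> C) by rewrite !pnatr_eq0.
  by apply: (mulfI j0); rewrite mulrA E mulrA mulfV // mul1r mulrAC mulfV // mul1r.
apply: cvgCMl; apply: cvgCB; last exact: cvg_cst.
by have := @cvg_negbin_sum j; rewrite -(cvg_shiftS (negbin_sum j)).
Qed.
End NegativeBinomial.


Section ComplexLogarithm.
Variable u : C.
Hypothesis u_small : normc u <= 4^-1.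

Lemma sub1_ge (t : R) : 0 <= t <= 1 -> 3 / 4 <= 1 - t * complex.Re u.
Proof.
move=> /andP[t0 t1]; suff : t * complex.Re u <= 4^-1 by lra.
apply: (@le_trans _ _ (t * normc u)).
  apply: ler_wpM2l => //; rewrite (le_trans (ler_norm _)) // -lecR.
  exact: normc_ge_Re.
by apply: (le_trans _ u_small); rewrite ler_piMl ?normc_ge0.
Qed.

Lemma normc_sub1_ge (t : R) : 0 <= t <= 1 -> 2^-1 <= normc (1 - t%:C * u).
Proof.
move=> t01; apply: (@le_trans _ _ (3 / 4)); first by lra.
apply: (le_trans (sub1_ge t01)); rewrite (le_trans (ler_norm _)) // -lecR.
apply: le_trans (normc_ge_Re _).
by rewrite lecR; case: (u) => a b /=; rewrite !mul0r subr0.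
Qed.

(** Here [phi] is the real or the imaginary part, and [L t] the corresponding part of
    log (1 - t u): the mean value theorem, which needs real values, bounds the remainder
    of the expansion of log (1 - u). *)
Lemma log_series_component (phi : {additive C -> R}) (L : R -> R) n :
  (forall (r : R) z, phi (r%:C * z) = r * phi z) ->
  (forall z, `|phi z| <= normc z) ->
  (forall t : R, 0 <= t <= 1 -> is_derive t (1 : R) L (phi (- u / (1 - t%:C * u)))) ->
  `|phi (\sum_(m < n) u ^+ m.+1 / m.+1%:R) + (L 1 - L 0)| <= 2 * 4^-1 ^+ n.
Proof.
move=> phiZ phi_le dL.
pose p := \sum_(m < n) (phi (u ^+ m.+1) / m.+1%:R) *: 'X^(m.+1) : {poly R}.
have p0 : p.[0] = 0.
  by rewrite horner_sum big1 // => m _; rewrite hornerZ hornerXn expr0n mulr0.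
have p1 : p.[1] = phi (\sum_(m < n) u ^+ m.+1 / m.+1%:R).
  rewrite horner_sum raddf_sum; apply: eq_bigr => m _.
  rewrite hornerZ hornerXn expr1n mulr1 mulrC -phiZ mulrC; congr (phi (_ * _)).
  by rewrite fmorphV rmorph_nat.
(* [p] collects the partial sum along the segment from 0 to u; the derivative of
   [p + L] is the remainder of a geometric series. *)
have dpL (t : R) : 0 <= t <= 1 ->
    is_derive t (1 : R) (fun s => p.[s] + L s) (phi (- u * (t%:C * u) ^+ n / (1 - t%:C * u))).
  move=> t01; have := is_deriveD (is_derive_poly p t) (dL t t01).
  move=> D; apply: (is_derive_eq D).
  have -> : p^`().[t] = phi (u * \sum_(m < n) (t%:C * u) ^+ m).
    rewrite /p linear_sum horner_sum mulr_sumr raddf_sum; apply: eq_bigr => m _.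
    rewrite /= derivZ derivXn hornerZ hornerMn hornerXn exprMn mulrCA -exprS.
    by rewrite -rmorphXn phiZ /= -[_ ^+ m *+ _]mulr_natr mulrCA divfK ?pnatr_eq0.
  rewrite -raddfD; congr (phi _).
  have nz : 1 - t%:C * u != 0.
    apply/eqP => z0; have := normc_sub1_ge t01.
    by rewrite z0 Normc.normc0; lra.
  apply: (mulIf nz); rewrite mulrDl !divfK //.
  rewrite -(opprB _ 1) mulrN -mulrA (mulrC (\sum_(m < n) _)) -subrX1.
  by ring.
have cont : {within `[0, 1], continuous (fun s => p.[s] + L s)}.
  apply: derivable_within_continuous => t; rewrite in_itv /= => t01.
  by have [] := dpL t t01.
have dpL' (t : R) : t \in `]0, 1[ ->
    is_derive t (1 : R) (fun s => p.[s] + L s) (phi (- u * (t%:C * u) ^+ n / (1 - t%:C * u))).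
  by rewrite in_itv => /andP[t0 t1]; apply: dpL; rewrite !ltW.
have [t] := MVT ltr01 dpL' cont.
rewrite in_itv subr0 mulr1 p0 p1 add0r addrA => /andP[t0 t1] ->.
have t01 : 0 <= t <= 1 by rewrite !ltW.
apply: (le_trans (phi_le _)); rewrite Normc.normcM Normc.normcV.
rewrite ler_pdivrMr; last by apply: lt_le_trans (normc_sub1_ge t01); lra.
have tu : normc (t%:C * u) <= 4^-1.
  rewrite (le_trans _ u_small) // Normc.normcM normcR ger0_norm ?(ltW t0) //.
  by rewrite ler_piMl ?normc_ge0 // ltW.
rewrite Normc.normcM normcX normcN.
apply: (@le_trans _ _ (1 * 4^-1 ^+ n)).
  apply: ler_pM; rewrite ?exprn_ge0 ?normc_ge0 //; last first.
    by rewrite lerXn2r ?nnegrE ?normc_ge0.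
  by apply: (le_trans u_small); lra.
rewrite mulrAC ler_wpM2r ?exprn_ge0 //.
by have := normc_sub1_ge t01; lra.
Qed.

Lemma ln_sqrt (x : R) : 0 < x -> ln (Num.sqrt x) = 2^-1 * ln x.
Proof.
move=> x0; have s0 : 0 < Num.sqrt x by rewrite sqrtr_gt0.
by rewrite -[in RHS](sqr_sqrtr (ltW x0)) lnXn // -[ln _ *+ 2]mulr_natl mulKf // pnatr_eq0.
Qed.

(** On the right half-plane the two-case definition by [acos] is smooth: it is an [atan],
    which can be differentiated. *)
Lemma Carg_atan (z : C) : 0 < complex.Re z -> Carg z = atan (complex.Im z / complex.Re z).
Proof.
case: z => a b /= a0; rewrite /Carg /=.
have -> : a / Num.sqrt (a ^+ 2 + b ^+ 2) = cos (atan (b / a)).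
  have -> : a ^+ 2 + b ^+ 2 = a ^+ 2 * (1 + (b / a) ^+ 2).
    by field; rewrite gt_eqF.
  rewrite cos_atan sqrtrM ?sqr_ge0 // sqrtr_sqr gtr0_norm // invfM mulrA.
  by rewrite mulfV ?mul1r // gt_eqF.
have [lo hi] := (atan_gtNpi2 (b / a), atan_ltpi2 (b / a)).
have pi0 := pi_gt0 R.
have [b0|b0] := leP 0 b.
  rewrite cosK // in_itv /= -atan0 le_atan ?divr_ge0 ?(ltW a0) //=.
  by lra.
rewrite cosKN ?opprK //; have : atan (b / a) <= atan 0.
  by apply: le_atan; rewrite ler_pdivrMr // mul0r ltW.
by rewrite atan0; lra.
Qed.

Lemma Re_div (z w : C) : complex.Re (z / w) =
  (complex.Re z * complex.Re w + complex.Im z * complex.Im w)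
  / (complex.Re w ^+ 2 + complex.Im w ^+ 2).
Proof. by case: z => a b; case: w => x y /=; rewrite mulrN opprK mulrDl !mulrA. Qed.

Lemma Im_div (z w : C) : complex.Im (z / w) =
  (complex.Im z * complex.Re w - complex.Re z * complex.Im w)
  / (complex.Re w ^+ 2 + complex.Im w ^+ 2).
Proof.
by case: z => a b; case: w => x y /=; rewrite mulrN mulrDl mulNr !mulrA addrC.
Qed.

Lemma Re_sub1 (t : R) : complex.Re (1 - t%:C * u) = 1 - t * complex.Re u.
Proof. by case: (u) => a b /=; rewrite mul0r subr0. Qed.

Lemma Im_sub1 (t : R) : complex.Im (1 - t%:C * u) = - (t * complex.Im u).
Proof. by case: (u) => a b /=; rewrite mul0r addr0 sub0r. Qed.

Let sub1_poly : {poly R} := 1 - complex.Re u *: 'X.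

Lemma is_derive_log_norm (t : R) : 0 <= t <= 1 ->
  is_derive t (1 : R)
    (fun t => 2^-1 * ln ((1 - t * complex.Re u) ^+ 2 + (t * complex.Im u) ^+ 2))
    (complex.Re (- u / (1 - t%:C * u))).
Proof.
move=> t01; have r0 := sub1_ge t01.
pose q := sub1_poly ^+ 2 + (complex.Im u *: 'X) ^+ 2 : {poly R}.
have qE s : q.[s] = (1 - s * complex.Re u) ^+ 2 + (s * complex.Im u) ^+ 2.
  by rewrite /q /sub1_poly !hornerE !(mulrC _ s).
have q0 : 0 < q.[t].
  by rewrite qE ltr_pwDl ?sqr_ge0 // exprn_gt0 //; lra.
rewrite (_ : (fun t => _) = 2^-1 \*: (@ln R \o horner q)); last first.
  by apply/funext => s /=; rewrite qE.
have D := is_deriveZ 2^-1 (is_derive1_comp (is_derive1_ln q0) (is_derive_poly q t)).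
apply: (is_derive_eq D).
rewrite Re_div Re_sub1 Im_sub1 !raddfN /=.
rewrite sqrrN -qE.
have -> : q^`().[t] = 2 * (- complex.Re u * (1 - t * complex.Re u)
    + complex.Im u * (t * complex.Im u)).
  rewrite /q /sub1_poly !(derivD, derivN, deriv_exp, derivZ, derivX, derivC).
  by rewrite !hornerE /=; ring.
by rewrite mulrNN /GRing.scale /=; field; apply: lt0r_neq0.
Qed.

Lemma is_derive_log_arg (t : R) : 0 <= t <= 1 ->
  is_derive t 1 (fun t => atan (- (t * complex.Im u) / (1 - t * complex.Re u)))
    (complex.Im (- u / (1 - t%:C * u))).
Proof.
move=> t01; have r0 := sub1_ge t01.
have s0 : sub1_poly.[t] != 0 by rewrite /sub1_poly !hornerE mulrC; lra.
pose g s := (- complex.Im u *: 'X).[s] / sub1_poly.[s].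
rewrite (_ : (fun t => _) = @atan R \o g); last first.
  apply/funext => s /=; rewrite /g /sub1_poly !hornerE.
  by rewrite !mulNr ![s * _]mulrC.
have D := is_derive1_comp (is_derive1_atan (g t))
  (is_deriveM (is_derive_poly (- complex.Im u *: 'X) t)
     (is_deriveV s0 (is_derive_poly sub1_poly t))).
apply: (is_derive_eq D).
rewrite Im_div Re_sub1 Im_sub1 !raddfN /= /g /sub1_poly.
rewrite !(derivD, derivN, derivZ, derivX, derivC) !hornerE /GRing.scale /=.
field; apply/andP; split; last by rewrite mulrC; apply: lt0r_neq0; lra.
apply: lt0r_neq0; rewrite ltr_pwDl ?sqr_ge0 // exprn_gt0 //; lra.
Qed.

Lemma Im_le_normc (z : C) : `|complex.Im z| <= normc z.
Proof. by case: z => a b /=; rewrite -sqrtr_sqr ler_wsqrtr // lerDr sqr_ge0. Qed.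

Lemma normc_le (z : C) : normc z <= `|complex.Re z| + `|complex.Im z|.
Proof.
case: z => a b /=; rewrite -[leRHS]ger0_norm ?addr_ge0 // -sqrtr_sqr.
rewrite ler_wsqrtr // sqrrD !real_normK ?num_real // -addrA lerD2l lerDr.
by rewrite mulrn_wge0 // mulr_ge0.
Qed.

(** The bounds on the real and the imaginary part at t = 1 control the modulus. *)
Theorem cvg_log_series :
  \sum_(m < n) (u ^+ m.+1 / m.+1%:R) @[n --> \oo] --> - Clog (1 - u).
Proof.
apply: (@cvg_geometric_bound _ _ 4 4^-1) => [|n]; first by lra.
rewrite opprK; set S := \sum_(m < n) _.
have r01 := @sub1_ge 1; rewrite mul1r ler01 lexx /= in r01.
have r1 : 0 < 1 - complex.Re u by have := r01 isT; lra.
have re := @log_series_component (@complex.Re R : {additive C -> R}) _ n _ _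
  is_derive_log_norm.
have im := @log_series_component (@complex.Im R : {additive C -> R}) _ n _ _
  is_derive_log_arg.
have {}re : `|complex.Re (S + Clog (1 - u))| <= 2 * 4^-1 ^+ n.
  have -> : complex.Re (S + Clog (1 - u)) = complex.Re S + (
      2^-1 * ln ((1 - 1 * complex.Re u) ^+ 2 + (1 * complex.Im u) ^+ 2)
      - 2^-1 * ln ((1 - 0 * complex.Re u) ^+ 2 + (0 * complex.Im u) ^+ 2)).
    rewrite (raddfD (@complex.Re R : {additive C -> R})); congr (_ + _).
    rewrite !mul0r expr0n subr0 addr0 expr1n ln1 mulr0 subr0 !mul1r.
    rewrite -ln_sqrt; last by rewrite ltr_pwDl ?sqr_ge0 ?exprn_gt0.
    by case: (u) => x y /=; rewrite sub0r sqrrN.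
  apply: re => [r [x y]|z] /=; first by rewrite mul0r subr0.
  by rewrite -lecR; apply: normc_ge_Re.
have {}im : `|complex.Im (S + Clog (1 - u))| <= 2 * 4^-1 ^+ n.
  have -> : complex.Im (S + Clog (1 - u)) = complex.Im S + (
      atan (- (1 * complex.Im u) / (1 - 1 * complex.Re u))
      - atan (- (0 * complex.Im u) / (1 - 0 * complex.Re u))).
    rewrite (raddfD (@complex.Im R : {additive C -> R})); congr (_ + _).
    rewrite !mul0r oppr0 mul0r atan0 subr0 !mul1r [LHS]/= Carg_atan.
      by case: (u) => x y /=; rewrite sub0r.
    by move: r1; case: (u).
  apply: im => [r [x y]|z] /=; first by rewrite mul0r addr0.
  exact: Im_le_normc.
apply: (le_trans (normc_le _)); lra.
Qed.

End ComplexLogarithm.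
End ComplexSeries.

(** * The zeta function *)

Section ComplexExponential.
Variable R : realType.
Implicit Types z w : R[i].

Lemma CexpD z w : Cexp (z + w) = Cexp z * Cexp w.
Proof.
case: z => a b; case: w => x y; rewrite /Cexp /= expRD cosD sinD.
by apply/eqP; rewrite eq_complex /=; apply/andP; split; apply/eqP; ring.
Qed.

Lemma Cexp0 : Cexp (0 : R[i]) = 1.
Proof. by rewrite /Cexp /= expR0 cos0 sin0 mulr1 mulr0. Qed.

Lemma Cexp_sum (I : Type) (r : seq I) (F : I -> R[i]) :
  Cexp (\sum_(i <- r) F i) = \prod_(i <- r) Cexp (F i).
Proof. exact: (big_morph _ CexpD Cexp0). Qed.

Lemma div1_Cpow w z : 1 / Cpow w (- z) = Cexp (z * Clog w).
Proof.
have E : Cexp (z * Clog w) * Cpow w (- z) = 1.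
  by rewrite /Cpow -CexpD mulNr subrr Cexp0.
have : Cpow w (- z) != 0.
  by apply: contra_eq_neq E => ->; rewrite mulr0 eq_sym oner_neq0.
by move=> n0; apply: (mulIf n0); rewrite divfK // E.
Qed.

End ComplexExponential.

(** The binomial theorem for 1 / (1 - u) = 1 + u / (1 - u). *)
Lemma expand_geometric (K : fieldType) (u : K) i : 1 - u != 0 ->
  (1 - u) ^- i - 1 = \sum_(1 <= j < i.+1) 'C(i, j)%:R * (u / (1 - u)) ^+ j.
Proof.
move=> u1; have -> : (1 - u) ^- i = (1 + u / (1 - u)) ^+ i.
  by rewrite -exprVn; congr (_ ^+ _); field.
rewrite exprDn -(big_mkord xpredT (fun j =>
  1 ^+ (i - j) * (u / (1 - u)) ^+ j *+ 'C(i, j))) big_ltn //.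
rewrite expr1n expr0 mulr1 bin0 mulr1n [LHS]addrC addrA addNr add0r.
by apply: eq_bigr => j _; rewrite expr1n mul1r mulr_natl.
Qed.

(** The sum over m of binomial (m + i, i) u^(m+1) / (m+1). *)
Definition negbin_primitive (R : realType) (i : nat) (u : R[i]) : R[i] :=
  if i is 0 then - Clog (1 - u) else i%:R^-1 * ((1 - u) ^- i - 1).

Lemma cvg_negbin_primitive_sum (R : realType) (u : R[i]) i :
  Normc.normc u <= 4^-1 ->
  \sum_(m < n) ('C(m + i, i)%:R / m.+1%:R * u ^+ m.+1) @[n --> \oo]
    --> negbin_primitive i u.
Proof.
move=> u4; case: i => [|i]; last exact: cvg_negbin_primitive.
rewrite (_ : (fun n => _) = fun n => \sum_(m < n) (u ^+ m.+1 / m.+1%:R)).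
  exact: cvg_log_series.
by apply/funext => n; apply: eq_bigr => m _; rewrite bin0 mul1r mulrC.
Qed.

Lemma cvg_sumC (R : realType) (I : Type) (r : seq I) (F : I -> nat -> R[i])
    (l : I -> R[i]) : (forall i, F i @ \oo --> l i) ->
  \sum_(i <- r) F i n @[n --> \oo] --> \sum_(i <- r) l i.
Proof. by move=> Fl; apply: cvg_big => //; apply: add_continuous. Qed.

Section LogZeta.
Variables (R : realType) (I : finCat) (N : nat) (x : 'I_N -> I).
Hypothesis x_bij : bijective x.
Variables (n : nat) (alpha : 'I_n -> R[i]) (e : 'I_n -> nat).
Variables (a : 'I_n -> nat -> R[i]) (d : R[i]).
Hypothesis d_neq0 : d != 0.
Hypothesis alpha_neq0 : forall k, alpha k != 0.
Hypothesis pow : forall m,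
  mxsum (adjacency R x ^+ m.+1) = d^-1 * \sum_(k < n) \sum_(1 <= j < (e k).+1)
    a k j * ((-1) ^+ j * alpha k ^- (j + m) * 'C(m + j.-1, j.-1)%:R).

Lemma cvg_zeta_series z :
  (forall k, Normc.normc (1 / alpha k * z) <= 4^-1) ->
  series (zeta_term I z) @ \oo --> \sum_(k < n) \sum_(0 <= i < e k)
    (d^-1 * a k i.+1 * (-1) ^+ i.+1 * alpha k ^- i)
      * negbin_primitive i (1 / alpha k * z).
Proof.
move=> zsmall.
rewrite (_ : series _ = fun p => \sum_(k < n) \sum_(0 <= i < e k)
    (d^-1 * a k i.+1 * (-1) ^+ i.+1 * alpha k ^- i)
      * \sum_(m < p) ('C(m + i, i)%:R / m.+1%:R * (1 / alpha k * z) ^+ m.+1)).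
  apply: cvg_sumC => k; apply: cvg_sumC => i; apply: cvgCMl.
  exact: cvg_negbin_primitive_sum.
apply/funext => p; rewrite /series /= big_mkord.
under [RHS]eq_bigr => k _ do under eq_bigr => i _ do rewrite mulr_sumr.
under [RHS]eq_bigr => k _ do rewrite exchange_big /=.
rewrite [RHS]exchange_big /=; apply: eq_bigr => m _.
rewrite /zeta_term (card_chains R x_bij) pow -!mulrA mulr_suml mulr_sumr.
apply: eq_bigr => k _; rewrite big_add1 mulr_suml mulr_sumr.
apply: eq_bigr => i _ /=.
have m0 : m.+1%:R != 0 :> R[i] by rewrite pnatr_eq0.
rewrite addSnnS exprMn exprD div1r exprVn.
by field; rewrite !expf_neq0 // nat1r m0 d_neq0.
Qed.

(** The terms with i = 0 are the logarithms and form the product; the terms with i > 0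
    are rearranged by [expand_geometric] and an exchange of the sums over i and j. *)
Lemma zeta_formula z :
  (forall k, Normc.normc (1 / alpha k * z) <= 4^-1) ->
  (forall k, (0 < e k)%N) ->
  Cexp (\sum_(k < n) \sum_(0 <= i < e k)
    (d^-1 * a k i.+1 * (-1) ^+ i.+1 * alpha k ^- i)
      * negbin_primitive i (1 / alpha k * z)) =
  (\prod_(k < n) (1 / Cpow (1 - 1 / alpha k * z) (- (a k 1%N / d))))
  * Cexp (1 / d * \sum_(k < n) \sum_(1 <= j < e k)
      z ^+ j / (j%:R * (1 - 1 / alpha k * z) ^+ j) *
      \sum_(j <= i < e k)
        j%:R * 'C(i, j)%:R * (-1) ^+ i.+1 * (1 / alpha k) ^+ (i + j)
          * a k i.+1 / i%:R).
Proof.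
move=> zsmall e_gt0.
under [X in _ = X * _]eq_bigr => k _ do rewrite div1_Cpow.
rewrite -Cexp_sum -CexpD mulr_sumr -big_split; congr (Cexp _).
apply: eq_bigr => k _; rewrite big_ltn //=; congr (_ + _).
  by rewrite expr1 expr0 invr1; ring.
set u := 1 / alpha k * z.
have u1 : 1 - u != 0 by apply: one_sub_neq0; apply: zsmall.
transitivity (1 / d * \sum_(1 <= j < e k) \sum_(j <= i < e k)
    a k i.+1 * (-1) ^+ i.+1 * alpha k ^- i / i%:R
      * ('C(i, j)%:R * (u / (1 - u)) ^+ j)); last first.
  congr (_ * _); rewrite !big_nat; apply: eq_bigr => j /andP[j1 _].
  rewrite mulr_sumr !big_nat; apply: eq_bigr => i /andP[ji _].
  have j0 : j%:R != 0 :> R[i] by rewrite pnatr_eq0; lia.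
  have i0 : i%:R != 0 :> R[i] by rewrite pnatr_eq0; lia.
  rewrite -[alpha k ^- i]exprVn !div1r; set b := (alpha k)^-1; set w := 1 - _.
  rewrite exprD exprMn [w^-1 ^+ j]exprVn /u div1r -/b exprMn.
  have w0 : w != 0 := u1.
  by field; rewrite i0 j0 expf_neq0.
rewrite exchange_triangle mulr_sumr !big_nat; apply: eq_bigr => i /andP[i1 _].
case: i i1 => // i _; rewrite -mulr_sumr -expand_geometric //=.
by rewrite mul1r; ring.
Qed.

End LogZeta.

Theorem mainTheorem1 (R : realType) (I : finCat)
    (N : nat) (x : 'I_N -> I) (x_bij : bijective x)
    (n : nat) (alpha : 'I_n -> R[i]) (e : 'I_n -> nat)
    (a : 'I_n -> nat -> R[i]) :
  let A := adjacency R x in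
  let d := (-1) ^+ N * \det A in
  let P := one_sub_mxX A in
  \det A != 0 ->
  (forall k, (1 <= e k)%N) ->
  injective alpha ->
  \det P = d%:P * \prod_(k < n) ('X - (alpha k)%:P) ^+ e k ->
  tofrac (mxsum (\adj P *m map_mx polyC A)) / tofrac (\det P) =
    (tofrac d%:P)^-1 *
    \sum_(k < n) \sum_(1 <= j < (e k).+1)
      tofrac (a k j)%:P / tofrac ('X - (alpha k)%:P) ^+ j ->
  [/\ \forall z \near (0 : R[i]),
        cvgn (series (zeta_term I z)) /\
        zeta I z =
          (\prod_(k < n) (1 / Cpow (1 - 1 / alpha k * z) (- (a k 1%N / d))))
          * Cexp (1 / d * \sum_(k < n) \sum_(1 <= j < e k)
              z ^+ j / (j%:R * (1 - 1 / alpha k * z) ^+ j) *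
              \sum_(j <= i < e k)
                j%:R * 'C(i, j)%:R * (-1) ^+ i.+1 * (1 / alpha k) ^+ (i + j)
                  * a k i.+1 / i%:R),
      \sum_(k < n) - (a k 1%N / d) = N%:R,
      forall k, eigenvalue A (1 / alpha k) /\
                integralOver (intr : int -> R[i]) (1 / alpha k)
    & series_Euler_char x
        (\sum_(k < n) - (a k 1%N / d) / (1 / alpha k)
         + 1 / d * \sum_(k < n) \sum_(1 <= j < e k)
             (-1) ^+ j *
             ((\sum_(j <= i < e k)
                 'C(i.-1, j.-1)%:R * (-1) ^+ i.-1 * (1 / alpha k) ^+ (i + j)
                   * a k i.+1)
              / (1 / alpha k) ^+ j.+1))].
Proof.
move=> A d P detA e_gt0 _ detP pf.
have d0 : d != 0 by rewrite mulf_neq0 // signr_eq0.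
have a0 k : alpha k != 0 by apply: (pole_neq0 detP (e_gt0 k)).
have pow m := mxsum_pow d0 detP pf m e_gt0.
have [top1 top2] := num_at_infinity d0 detP pf detA erefl e_gt0.
split.
- have : \forall z \near (0 : R[i]), forall k, `|z| < `|alpha k| / 4.
    apply: (@filter_forall R[i] _ (fun k z => `|z| < `|alpha k| / 4) _
      (nbhs_filter (0 : R[i]))) => k.
    apply: (@nbhs0_lt _ R[i]).
    by rewrite divr_gt0 // normr_gt0.
  apply: filterS => z zsmall.
  have zsmall' k : Normc.normc (1 / alpha k * z) <= 4^-1.
    rewrite -lecR [X in X <= _](_ : _ = `|1 / alpha k * z|) // normrM normrM normr1.
    rewrite mul1r normfV mulrC ler_pdivrMr ?normr_gt0 // mulrC.
    by rewrite fmorphV rmorph_nat ltW.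
  have cvgz := cvg_zeta_series x_bij d0 a0 pow zsmall'.
  split; first by apply/cvg_ex; eexists; exact: cvgz.
  rewrite /zeta (cvg_lim (@norm_hausdorff _ _) cvgz).
  exact: zeta_formula.
- by rewrite sumrN -mulr_suml top1 mulNr opprK mulrAC mulfV // mul1r.
- move=> k; have ev := eigenvalue_pole detP (e_gt0 k); rewrite div1r.
  split=> //; apply: (integralOver_eigenvalue (M := \matrix_(i, j) #|Defs.Hom (x i) (x j)|) _ ev).
  by apply/matrixP => i j; rewrite !mxE.
- have -> : \sum_(k < n) - (a k 1%N / d) / (1 / alpha k) + 1 / d *
      \sum_(k < n) \sum_(1 <= j < e k) (-1) ^+ j *
        ((\sum_(j <= i < e k)
           'C(i.-1, j.-1)%:R * (-1) ^+ i.-1 * (1 / alpha k) ^+ (i + j) * a k i.+1)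
          / (1 / alpha k) ^+ j.+1) = mxsum (invmx A).
    under [X in 1 / d * X]eq_bigr => k _ do rewrite sum_binomial_poles //.
    have -> : mxsum (invmx A) = - (\sum_(k < n) (a k 1%N * alpha k +
        (if (1 < e k)%N then a k 2%N else 0))) / d.
      by rewrite top2 opprK mulrAC mulfV // mul1r.
    rewrite -sumrN mulr_suml mulr_sumr -big_split; apply: eq_bigr => k _ /=.
    by set v := (if _ then _ else _); field; rewrite d0 a0.
  exact: (series_Euler_char_invmx detA).
Qed.
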